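(* The system $\mathsf{DG}+\mathsf{CCT}_C$ is inconsistent, where $\mathsf{CCT}_C$ is $(\forall^{\mathrm{st}}Y^{2})\big(\mathsf{cont}_C(Y)\rightarrow[\mathsf{cont}_C(Y)]^{\mathrm{st}}\big)$, with $\mathsf{cont}_C(Y)$ the formula $(\forall f\le_1 1)(\exists N^{0})(\forall g\le_1 1)\big(\overline{f}N=\overline{g}N\rightarrow Y(f)=Y(g)\big)$ and $[\mathsf{cont}_C(Y)]^{\mathrm{st}}$ the formula $(\forall^{\mathrm{st}} f\le_1 1)(\exists^{\mathrm{st}} N^{0})(\forall^{\mathrm{st}} g\le_1 1)\big(\overline{f}N=\overline{g}N\rightarrow Y(f)=Y(g)\big)$.
   Context: $\overline{f}N=\langle f(0),\dots,f(N-1)\rangle$. Finite types: $0$ is a type and if $\rho,\sigma$ are types so is $\rho\to\sigma$; type $1=0\to0$, $2=1\to0$. $\mathsf{E\text{-}HA}^{\omega}$ is Heyting arithmetic in all finite types (intuitionistic logic, Gödel's $T$ constants) with extensionality. Equality $=_0$ is primitive; for $\tau=\tau_1\to\dots\to\tau_k\to0$, $x=_\tau y$ abbreviates $(\forall z_1\dots z_k)(xz_1\dots z_k=_0yz_1\dots z_k)$, and $\le_\tau$ likewise. Extensionality $(\mathsf E_{\rho\to\tau})$: $(\forall\varphi)(\forall x,y)(x=_\rho y\to\varphi(x)=_\tau\varphi(y))$, for all types. Binary sequences: $f\le_1 1$. Strong majorizability (Howard–Bezem): $x\le^*_0 y$ iff $x\le_0 y$; $x\le^*_{\rho\to\sigma}y$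 iff for all $u,v$ with $u\le^*_\rho v$: $xu\le^*_\sigma yv$ and $yu\le^*_\sigma yv$. Monotone: $x\le^*x$; $\tilde\forall,\tilde\exists$ range over monotone objects. The language of $\mathsf{DG}$ adds predicates $\mathrm{st}^\sigma$ (''is standard''); $\forall^{\mathrm{st}},\exists^{\mathrm{st}}$ are the relativised quantifiers, $\tilde\forall^{\mathrm{st}},\tilde\exists^{\mathrm{st}}$ combine both restrictions. Internal = not containing $\mathrm{st}$. $\mathsf{DG}$ is $\mathsf{E\text{-}HA}^\omega$ in the extended language plus: (a) $x=_\sigma y\to(\mathrm{st}(x)\to\mathrm{st}(y))$; (b) $\mathrm{st}(y)\to(x\le^*_\sigma y\to\mathrm{st}(x))$; (c) $\mathrm{st}(t)$ for closed terms $t$; (d) $\mathrm{st}(z)\to(\mathrm{st}(x)\to\mathrm{st}(zx))$; external induction $\Phi(0)\wedge(\forall^{\mathrm{st}}n)(\Phi(n)\to\Phi(n+1))\to(\forall^{\mathrm{st}}n)\Phi(n)$ for any $\Phi$; and for arbitrary $\Phi,\Psi$ and internal $\phi,\psi$: $\mathsf{mAC}^\omega$: $(\tilde\forall^{\mathrm{st}}x)(\tilde\exists^{\mathrm{st}}y)\Phi(x,y)\to(\tilde\exists^{\mathrm{st}}f)(\tilde\forall^{\mathrm{st}}x)(\exists y\le^*f(x))\Phi(x,y)$; $\mathsf R^\omega$: $(\forall x)(\exists^{\mathrm{st}}y)\Phi(x,y)\to(\tilde\exists^{\mathrm{st}}z)(\forall x)(\exists y\le^*z)\Phi(x,y)$;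 $\mathsf I^\omega$: $(\tilde\forall^{\mathrm{st}}z)(\exists x)(\forall y\le^*z)\phi(x,y)\to(\exists x)(\forall^{\mathrm{st}}y)\phi(x,y)$; $\mathsf{IP}^\omega_{\tilde\forall^{\mathrm{st}}}$: $[(\tilde\forall^{\mathrm{st}}x)\phi(x)\to(\tilde\exists^{\mathrm{st}}y)\Psi(y)]\to(\tilde\exists^{\mathrm{st}}z)[(\tilde\forall^{\mathrm{st}}x)\phi(x)\to(\tilde\exists y\le^*z)\Psi(y)]$; $\mathsf M^\omega$: $[(\tilde\forall^{\mathrm{st}}x)\phi(x)\to\psi]\to(\tilde\exists^{\mathrm{st}}y)[(\forall x\le^*y)\phi(x)\to\psi]$; $\mathsf{MAJ}^\omega$: $(\forall^{\mathrm{st}}x)(\exists^{\mathrm{st}}y)(x\le^*y)$. *)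

(* Defs.v *)
From Stdlib Require Import List.
Import ListNotations.

Set Implicit Arguments.
Unset Strict Implicit.
Unset Printing Implicit Defensive.

(** * Syntax: intrinsically typed, de Bruijn

    A context lists the types of the free variables, the most recently bound
    one first. *)

Inductive ty : Type :=
| o
| arr (rho sigma : ty).

Declare Scope dg_scope.
Delimit Scope dg_scope with dg.
Open Scope dg_scope.

Notation "rho '~>' sigma" := (arr rho sigma)
  (at level 55, right associativity) : dg_scope.

Notation ty1 := (o ~> o).
Notation ty2 := (ty1 ~> o).

Definition ctx := list ty.

Inductive var : ctx -> ty -> Type :=
| VZ (G : ctx) (s : ty) : var (s :: G) s
| VS (G : ctx) (s t : ty) : var G s -> var (t :: G) s.

(** The constants of Gödel's T: zero, successor, the combinators and the
    recursors. *)
Inductive const : ty -> Type :=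
| CZero : const o
| CSucc : const (o ~> o)
| CPi (r s : ty) : const (r ~> s ~> r)
| CSigma (r s t : ty) : const ((r ~> s ~> t) ~> (r ~> s) ~> r ~> t)
| CRec (r : ty) : const (o ~> r ~> (r ~> o ~> r) ~> r).

Inductive term (G : ctx) : ty -> Type :=
| Var (s : ty) : var G s -> term G s
| Con (s : ty) : const s -> term G s
| App (s t : ty) : term G (s ~> t) -> term G s -> term G t.

Arguments Con {G s}.

Notation "f '@' x" := (App f x) (at level 40, left associativity) : dg_scope.

Notation Zero := (Con CZero).
Notation Succ := (Con CSucc).
Notation Pi r s := (Con (CPi r s)).
Notation Sigma r s t := (Con (CSigma r s t)).
Notation Rec r := (Con (CRec r)).

Notation v0 := (Var (VZ _ _)).
Notation v1 := (Var (VS _ (VZ _ _))).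
Notation v2 := (Var (VS _ (VS _ (VZ _ _)))).
Notation v3 := (Var (VS _ (VS _ (VS _ (VZ _ _))))).

(** Equality at type [o] and the predicates [st] are the only atoms besides
    falsum. *)
Inductive form : ctx -> Type :=
| Bot (G : ctx) : form G
| Eq0 (G : ctx) : term G o -> term G o -> form G
| St (G : ctx) (s : ty) : term G s -> form G
| And (G : ctx) : form G -> form G -> form G
| Or (G : ctx) : form G -> form G -> form G
| Imp (G : ctx) : form G -> form G -> form G
| All (G : ctx) (s : ty) : form (s :: G) -> form G
| Ex (G : ctx) (s : ty) : form (s :: G) -> form G.

Arguments Bot {G}.
Arguments All {G} s _.
Arguments Ex {G} s _.

Notation "A '-->' B" := (Imp A B) (at level 85, right associativity) : dg_scope.
Notation "A '&&&' B" := (And A B) (at level 80, right associativity) : dg_scope.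
Notation "A '|||' B" := (Or A B) (at level 82, right associativity) : dg_scope.

Fixpoint internal (G : ctx) (A : form G) : Prop :=
  match A with
  | Bot => True
  | Eq0 _ _ => True
  | St _ => False
  | And A B | Or A B | Imp A B => internal A /\ internal B
  | All _ A | Ex _ A => internal A
  end.

(** * Substitution *)

Definition sub (G D : ctx) : Type := forall s, var G s -> term D s.

Fixpoint tsub (G D : ctx) (f : sub G D) (s : ty) (t : term G s) : term D s :=
  match t with
  | Var v => f _ v
  | Con c => Con c
  | App t u => tsub f t @ tsub f u
  end.

(** [t .: f] sends variable 0 to [t] and acts as [f] on the others. *)
Definition scons (G D : ctx) (r : ty) (t : term D r) (f : sub G D) :
    sub (r :: G) D :=
  fun s (v : var (r :: G) s) =>
    match v in var G' s' return
      match G' with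
      | [] => unit
      | r' :: G'' => term D r' -> sub G'' D -> term D s'
      end
    with
    | VZ _ _ => fun t _ => t
    | VS _ v => fun _ f => f _ v
    end t f.

Notation "t '.:' f" := (scons t f) (at level 60, right associativity) : dg_scope.

Definition ids (G : ctx) : sub G G := fun s v => Var v.
Definition up1 (G : ctx) (a : ty) : sub G (a :: G) :=
  fun s v => Var (VS a v).
Definition up2 (G : ctx) (a b : ty) : sub G (a :: b :: G) :=
  fun s v => Var (VS a (VS b v)).
Definition up3 (G : ctx) (a b c : ty) : sub G (a :: b :: c :: G) :=
  fun s v => Var (VS a (VS b (VS c v))).

Arguments ids {G}.
Arguments up1 {G a}.
Arguments up2 {G a b}.
Arguments up3 {G a b c}.

Definition closed_sub (D : ctx) : sub [] D :=
  fun s (v : var [] s) => match v with end.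

Arguments closed_sub {D}.

Definition lift (G D : ctx) (r : ty) (f : sub G D) : sub (r :: G) (r :: D) :=
  v0 .: (fun s v => tsub up1 (f s v)).

Fixpoint fsub (G D : ctx) (f : sub G D) (A : form G) : form D :=
  match A in form G return sub G D -> form D with
  | Bot => fun _ => Bot
  | Eq0 t u => fun f => Eq0 (tsub f t) (tsub f u)
  | St t => fun f => St (tsub f t)
  | And A B => fun f => fsub f A &&& fsub f B
  | Or A B => fun f => fsub f A ||| fsub f B
  | Imp A B => fun f => fsub f A --> fsub f B
  | All s A => fun f => All s (fsub (lift f) A)
  | Ex s A => fun f => Ex s (fsub (lift f) A)
  end f.

Notation "t '.[' f ]" := (tsub f t) (at level 2, left associativity,
  format "t .[ f ]") : dg_scope.
Notation "A '.{' f }" := (fsub f A) (at level 2, left associativity,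
  format "A .{ f }") : dg_scope.

(** * Intuitionistic natural deduction over a set of axioms *)

Definition theory : Type := forall G : ctx, form G -> Prop.

Inductive derives (T : theory) : forall G : ctx, list (form G) -> form G -> Prop :=
| d_ax G (H : list (form G)) A :
    T G A -> derives T H A
| d_hyp G (H : list (form G)) A :
    In A H -> derives T H A
| d_botE G (H : list (form G)) A :
    derives T H Bot -> derives T H A
| d_andI G (H : list (form G)) A B :
    derives T H A -> derives T H B -> derives T H (A &&& B)
| d_andE1 G (H : list (form G)) A B :
    derives T H (A &&& B) -> derives T H A
| d_andE2 G (H : list (form G)) A B :
    derives T H (A &&& B) -> derives T H B
| d_orI1 G (H : list (form G)) A B :
    derives T H A -> derives T H (A ||| B)
| d_orI2 G (H : list (form G)) A B :
    derives T H B -> derives T H (A ||| B)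
| d_orE G (H : list (form G)) A B C :
    derives T H (A ||| B) -> derives T (A :: H) C -> derives T (B :: H) C ->
    derives T H C
| d_impI G (H : list (form G)) A B :
    derives T (A :: H) B -> derives T H (A --> B)
| d_impE G (H : list (form G)) A B :
    derives T H (A --> B) -> derives T H A -> derives T H B
| d_allI G (H : list (form G)) s (A : form (s :: G)) :
    derives T (map (fsub up1) H) A -> derives T H (All s A)
| d_allE G (H : list (form G)) s (A : form (s :: G)) (t : term G s) :
    derives T H (All s A) -> derives T H A.{t .: ids}
| d_exI G (H : list (form G)) s (A : form (s :: G)) (t : term G s) :
    derives T H A.{t .: ids} -> derives T H (Ex s A)
| d_exE G (H : list (form G)) s (A : form (s :: G)) (B : form G) :
    derives T H (Ex s A) -> derives T (A :: map (fsub up1) H) B.{up1} ->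
    derives T H B.

Definition inconsistent (T : theory) : Prop := derives T (G := []) [] Bot.

Inductive extend (T : theory) (B : form []) : theory :=
| ext_old G (A : form G) : T G A -> extend T B A
| ext_new G : extend T B (G := G) B.{closed_sub}.

(** * Defined terms *)

(** Bracket abstraction: [lam t] is the combinator term for "lambda v0. t". *)
Definition lam_var (G : ctx) (r s : ty) (v : var (r :: G) s) : term G (r ~> s) :=
  match v in var G' s' return
    match G' with
    | [] => unit
    | r' :: G'' => term G'' (r' ~> s')
    end
  with
  | VZ _ r => Sigma r (r ~> r) r @ Pi r (r ~> r) @ Pi r r
  | VS r v => Pi _ r @ Var v
  end.

Fixpoint lam (G : ctx) (r s : ty) (t : term (r :: G) s) : term G (r ~> s) :=
  match t with
  | Var v => lam_var v
  | Con c => Pi _ r @ Con c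
  | App t u => Sigma r _ _ @ lam t @ lam u
  end.

Definition add (G : ctx) (x y : term G o) : term G o :=
  Rec o @ y @ x @ lam (lam (Succ @ v1)).

(** [triangle n] is 0 + 1 + ... + n. *)
Definition triangle (G : ctx) (n : term G o) : term G o :=
  Rec o @ n @ Zero @ lam (lam (Succ @ add v1 v0)).

(** Cantor's pairing. *)
Definition cpair (G : ctx) (x y : term G o) : term G o :=
  add (triangle (add x y)) y.

(** Codes of finite sequences: the empty sequence has code 0, and appending [x]
    to the sequence with code [s] yields the code [S (cpair s x)]. *)
Definition snoc (G : ctx) (s x : term G o) : term G o := Succ @ cpair s x.

(** The code of the sequence f(0), ..., f(N-1). *)
Definition initseg (G : ctx) (f : term G ty1) (N : term G o) : term G o :=
  Rec o @ N @ Zero @ lam (lam (snoc v1 (f.[up2] @ v0))).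

Definition one1 (G : ctx) : term G ty1 := lam (Succ @ Zero).
Arguments one1 {G}.

(** * Defined formulas *)

(** Pointwise equality and order at all types. *)
Fixpoint eqT (s : ty) (G : ctx) : term G s -> term G s -> form G :=
  match s with
  | o => fun x y => Eq0 x y
  | r ~> t => fun x y => All r (eqT (x.[up1] @ v0) (y.[up1] @ v0))
  end.

Definition le0 (G : ctx) (x y : term G o) : form G :=
  Ex o (Eq0 (add x.[up1] v0) y.[up1]).

Fixpoint leT (s : ty) (G : ctx) : term G s -> term G s -> form G :=
  match s with
  | o => fun x y => le0 x y
  | r ~> t => fun x y => All r (leT (x.[up1] @ v0) (y.[up1] @ v0))
  end.

(** Strong majorizability; in the second clause [u] is [v1] and [v] is [v0]. *)
Fixpoint maj (s : ty) (G : ctx) : term G s -> term G s -> form G :=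
  match s with
  | o => fun x y => le0 x y
  | r ~> t => fun x y =>
      All r (All r (maj v1 v0 -->
        maj (x.[up2] @ v1) (y.[up2] @ v0) &&&
        maj (y.[up2] @ v1) (y.[up2] @ v0)))
  end.

Definition all_st (G : ctx) s (A : form (s :: G)) : form G :=
  All s (St v0 --> A).
Definition ex_st (G : ctx) s (A : form (s :: G)) : form G :=
  Ex s (St v0 &&& A).
Definition all_mst (G : ctx) s (A : form (s :: G)) : form G :=
  all_st (maj v0 v0 --> A).
Definition ex_mst (G : ctx) s (A : form (s :: G)) : form G :=
  ex_st (maj v0 v0 &&& A).

Arguments all_st {G} s A.
Arguments ex_st {G} s A.
Arguments all_mst {G} s A.
Arguments ex_mst {G} s A.

(** * E-HA^omega, in the language with [st] *)

(** The induction schema inherited from E-HA^omega is for internal formulas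
    only: with [St v0] it would prove every natural number standard. *)
Inductive EHA : theory :=
| eha_refl G (x : term G o) :
    EHA (Eq0 x x)
| eha_sym G (x y : term G o) :
    EHA (Eq0 x y --> Eq0 y x)
| eha_trans G (x y z : term G o) :
    EHA (Eq0 x y --> Eq0 y z --> Eq0 x z)
| eha_succ_nz G (x : term G o) :
    EHA (Eq0 (Succ @ x) Zero --> Bot)
| eha_succ_inj G (x y : term G o) :
    EHA (Eq0 (Succ @ x) (Succ @ y) --> Eq0 x y)
| eha_pi G r s (x : term G r) (y : term G s) :
    EHA (eqT (Pi r s @ x @ y) x)
| eha_sigma G r s t
    (x : term G (r ~> s ~> t)) (y : term G (r ~> s)) (z : term G r) :
    EHA (eqT (Sigma r s t @ x @ y @ z) (x @ z @ (y @ z)))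
| eha_rec0 G r (x : term G r) (y : term G (r ~> o ~> r)) :
    EHA (eqT (Rec r @ Zero @ x @ y) x)
| eha_recS G r (n : term G o) (x : term G r) (y : term G (r ~> o ~> r)) :
    EHA (eqT (Rec r @ (Succ @ n) @ x @ y) (y @ (Rec r @ n @ x @ y) @ n))
| eha_ext G r s :
    EHA (G := G) (All (r ~> s) (All r (All r
      (eqT v1 v0 --> eqT (v2 @ v1) (v2 @ v0)))))
| eha_ind G (A : form (o :: G)) :
    internal A ->
    EHA (A.{Zero .: ids} --> All o (A --> A.{Succ @ v0 .: up1}) --> All o A).

(** * DG *)

(** A schema formula with two distinguished variables [x] and [y] lives in
    [s :: r :: G], with [x] as variable 1 and [y] as variable 0. *)
Inductive DG : theory :=
| dg_eha G (A : form G) :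
    EHA A -> DG A
| dg_st_eq G s (x y : term G s) :
    DG (eqT x y --> St x --> St y)
| dg_st_maj G s (x y : term G s) :
    DG (St y --> maj x y --> St x)
| dg_st_closed G s (t : term [] s) :
    DG (G := G) (St t.[closed_sub])
| dg_st_app G r s (z : term G (r ~> s)) (x : term G r) :
    DG (St z --> St x --> St (z @ x))
| dg_ext_ind G (Phi : form (o :: G)) :
    DG (Phi.{Zero .: ids} &&& all_st o (Phi --> Phi.{Succ @ v0 .: up1}) -->
        all_st o Phi)
| dg_mAC G r s (Phi : form (s :: r :: G)) :
    DG (all_mst r (ex_mst s Phi) -->
        ex_mst (r ~> s) (all_mst r (Ex s
          (maj v0 (v2 @ v1) &&& Phi.{v0 .: v1 .: up3}))))
| dg_R G r s (Phi : form (s :: r :: G)) :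
    DG (All r (ex_st s Phi) -->
        ex_mst s (All r (Ex s (maj v0 v2 &&& Phi.{v0 .: v1 .: up3}))))
| dg_I G r s (phi : form (s :: r :: G)) :
    internal phi ->
    DG (all_mst s (Ex r (All s (maj v0 v2 --> phi.{v0 .: v1 .: up3}))) -->
        Ex r (all_st s phi))
| dg_IP G r s (phi : form (r :: G)) (Psi : form (s :: G)) :
    internal phi ->
    DG ((all_mst r phi --> ex_mst s Psi) -->
        ex_mst s ((all_mst r phi).{up1} -->
          Ex s (maj v0 v0 &&& maj v0 v1 &&& Psi.{v0 .: up2})))
| dg_M G r (phi : form (r :: G)) (psi : form G) :
    internal phi -> internal psi ->
    DG ((all_mst r phi --> psi) -->
        ex_mst r (All r (maj v0 v1 --> phi.{v0 .: up2}) --> psi.{up1}))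
| dg_MAJ G s :
    DG (G := G) (all_st s (ex_st s (maj v1 v0))).

(** * Continuity on Cantor space *)

Definition binary (G : ctx) (f : term G ty1) : form G := leT f one1.

(** Under the three quantifiers [f], [N], [g] are [v2], [v1], [v0]. *)
Definition agree (G : ctx) (Y : term G ty2) : form (ty1 :: o :: ty1 :: G) :=
  Eq0 (initseg v2 v1) (initseg v0 v1) -->
  Eq0 (Y.[up3] @ v2) (Y.[up3] @ v0).

Definition contC (G : ctx) (Y : term G ty2) : form G :=
  All ty1 (binary v0 --> Ex o (All ty1 (binary v0 --> agree Y))).

(** The [st]-relativisation applies to the three displayed quantifiers; [binary]
    stays internal. *)
Definition contC_st (G : ctx) (Y : term G ty2) : form G :=
  all_st ty1 (binary v0 --> ex_st o (all_st ty1 (binary v0 --> agree Y))).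

Definition CCT_C : form [] := all_st ty2 (contC v0 --> contC_st v0).

(* Main.v *)
(** By [I^omega] some [m] bounds all standard numbers. Majorizability makes every
    binary sequence standard, as well as every type 2 functional bounded by 1,
    even when defined from [m]. Let [g] be the characteristic function of
    [m <= x] and [Y f := e (code of f(0), ..., f(m))], with [e] binary and
    separating the codes for [f := 0] and [f := g]. Then [Y] is standard, and it
    is continuous because it factors through the code of an initial segment. But
    [g] agrees with 0 below every standard [N], so no standard [N] is a modulus
    of continuity of [Y] at 0. *)

From Stdlib Require Import List RelationClasses.
From Stdlib Require Setoid Morphisms.
Import ListNotations.
Require Import Defs.

Set Implicit Arguments.
Unset Strict Implicit.
Unset Printing Implicit Defensive.

(* [Morphisms] cannot be imported: its notation for [flip] clashes with [-->]. *)
#[local] Notation Proper := Morphisms.Proper.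
#[local] Notation "R ==> S" := (Morphisms.respectful R S)
  (at level 55, right associativity).

(** * Substitution *)

Lemma tsub_comp G D K (f : sub G D) (g : sub D K) s (t : term G s) :
  t.[f].[g] = t.[fun r v => (f r v).[g]].
Proof. induction t; cbn; [reflexivity..|now rewrite IHt1, IHt2]. Qed.

Lemma tsub_ids G s (t : term G s) : t.[ids] = t.
Proof. induction t; cbn; [reflexivity..|now rewrite IHt1, IHt2]. Qed.

Lemma tsub_up1_scons G D r s (t : term G s) (u : term D r) (f : sub G D) :
  t.[up1].[u .: f] = t.[f].
Proof. exact (tsub_comp up1 (u .: f) t). Qed.

Lemma tsub_up1_lift G D r s (t : term G s) (f : sub G D) :
  t.[up1].[lift (r := r) f] = t.[f].[up1].
Proof. rewrite !tsub_comp. reflexivity. Qed.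

Lemma tsub_up2 G q r s (t : term G s) :
  t.[@up2 G q r] = t.[up1].[up1].
Proof. symmetry. exact (tsub_comp up1 up1 t). Qed.

Lemma tsub_up3 G p q r s (t : term G s) :
  t.[@up3 G p q r] = t.[up1].[up1].[up1].
Proof. rewrite <- tsub_up2. symmetry. exact (tsub_comp up1 up2 t). Qed.

#[local] Arguments ids {G} s v /.
#[local] Arguments up1 {G a} s v /.
#[local] Arguments up2 {G a b} s v /.
#[local] Arguments up3 {G a b c} s v /.

(** Inversion on a variable whose context is a cons. The motive is generalised over the context,
    with a trivial branch for the empty one, so no equation between contexts arises. *)
Definition var_case G r (P : forall s, var (r :: G) s -> Prop)
    (hz : P r (VZ _ _)) (hs : forall s v, P s (VS r v)) s (v : var (r :: G) s) :
    P s v :=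
  match v in var G' s' return
    match G' return var G' s' -> Prop with
    | [] => fun _ => True
    | r' :: G'' => fun v => forall P : forall s, var (r' :: G'') s -> Prop,
        P r' (VZ _ _) -> (forall s v, P s (VS r' v)) -> P s' v
    end v
  with
  | VZ _ _ => fun P hz _ => hz
  | VS _ v => fun P _ hs => hs _ v
  end P hz hs.

#[local] Hint Rewrite tsub_ids tsub_up2 tsub_up3 tsub_up1_scons tsub_up1_lift
  : sub.

Lemma eqT_sub s G D (x y : term G s) (f : sub G D) :
  (eqT x y).{f} = eqT x.[f] y.[f].
Proof.
  revert G D x y f; induction s as [|r _ s IH]; intros; cbn; [easy|].
  rewrite IH. cbn. now autorewrite with sub.
Qed.

Lemma le0_sub G D (x y : term G o) (f : sub G D) :
  (le0 x y).{f} = le0 x.[f] y.[f].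
Proof. unfold le0. cbn. now autorewrite with sub. Qed.

Lemma leT_sub s G D (x y : term G s) (f : sub G D) :
  (leT x y).{f} = leT x.[f] y.[f].
Proof.
  revert G D x y f; induction s as [|r _ s IH]; intros; cbn [leT].
  - apply le0_sub.
  - cbn. rewrite IH. cbn. now autorewrite with sub.
Qed.

Lemma maj_sub s G D (x y : term G s) (f : sub G D) :
  (maj x y).{f} = maj x.[f] y.[f].
Proof.
  revert G D x y f; induction s as [|r IHr s IHs]; intros; cbn [maj].
  - apply le0_sub.
  - cbn. rewrite IHr, !IHs. cbn. now autorewrite with sub.
Qed.

Lemma binary_sub G D (x : term G ty1) (f : sub G D) :
  (binary x).{f} = binary x.[f].
Proof. apply leT_sub. Qed.

#[local] Hint Rewrite eqT_sub le0_sub leT_sub maj_sub binary_sub : sub.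

Lemma derives_weaken (T : theory) G (H H' : list (form G)) A :
  derives T H A -> incl H H' -> derives T H' A.
Proof.
  intros d. revert H'.
  induction d; intros H' sub; try (econstructor; eauto; fail).
  - eapply d_orE; [eauto|apply IHd2|apply IHd3];
      (apply incl_cons; [now left|now apply incl_tl]).
  - apply d_impI, IHd. apply incl_cons; [now left|now apply incl_tl].
  - apply d_allI, IHd. now apply incl_map.
  - eapply d_exE; [eauto|]. apply IHd2.
    apply incl_cons; [now left|apply incl_tl; now apply incl_map].
Qed.

(** * Terms of the counterexample *)

Lemma add_sub G D (x y : term G o) (f : sub G D) :
  (add x y).[f] = add x.[f] y.[f].
Proof. reflexivity. Qed.

Lemma triangle_sub G D (x : term G o) (f : sub G D) :
  (triangle x).[f] = triangle x.[f].
Proof. reflexivity. Qed.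

Lemma snoc_sub G D (x y : term G o) (f : sub G D) :
  (snoc x y).[f] = snoc x.[f] y.[f].
Proof. reflexivity. Qed.

(** The step of [initseg] is a bracket abstraction over [f], so [initseg] does
    not commute with substitution syntactically; [iseg] does, and agrees with
    [initseg] on variables. *)
Definition iseg (G : ctx) (f : term G ty1) (N : term G o) : term G o :=
  Rec o @ N @ Zero @ (lam (lam (snoc v1 (v2 @ v0)))).[f .: ids].

Lemma iseg_sub G D f (N : term G o) (g : sub G D) :
  (iseg f N).[g] = iseg f.[g] N.[g].
Proof. reflexivity. Qed.

(** Brings in [iseg] before a substitution is pushed through a continuity formula; here the
    sequences are still variables, so both sides compute to the same formula. *)
Lemma agreeE G (Y : term G ty2) :
  agree Y = (Eq0 (iseg v2 v1) (iseg v0 v1) -->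
    Eq0 (Y.[up3] @ v2) (Y.[up3] @ v0)).
Proof. reflexivity. Qed.

Definition zero1 (G : ctx) : term G ty1 := lam Zero.
Arguments zero1 {G}.

Lemma zero1_sub G D (f : sub G D) : zero1.[f] = zero1.
Proof. reflexivity. Qed.

Definition one2 (G : ctx) : term G ty2 := lam (Succ @ Zero).
Arguments one2 {G}.

Lemma one2_sub G D (f : sub G D) : one2.[f] = one2.
Proof. reflexivity. Qed.

Lemma one1_sub G D (f : sub G D) : one1.[f] = one1.
Proof. reflexivity. Qed.

(** [threshold m] is the characteristic function of [m <= x]. *)
Definition threshold (G : ctx) (m : term G o) : term G ty1 :=
  Rec ty1 @ m @ one1
    @ lam (lam (lam (Rec o @ v0 @ Zero @ (Pi ty1 o @ v2)))).

Lemma threshold_sub G D m (f : sub G D) : (threshold m).[f] = threshold m.[f].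
Proof. reflexivity. Qed.

(** The functional [f |-> e (iseg f m)]; like [iseg], it commutes with
    substitution. *)
Definition eval_iseg (G : ctx) (e : term G ty1) (m : term G o) : term G ty2 :=
  (lam (v1 @ iseg v0 v2)).[e .: m .: ids].

Lemma eval_iseg_sub G D e m (f : sub G D) :
  (eval_iseg e m).[f] = eval_iseg e.[f] m.[f].
Proof. reflexivity. Qed.

(** The cut-off is the code of the segment of [threshold m], which exceeds that of [zero1]. Length
    [Succ @ m] is the first at which the two segments differ, namely at index [m]. *)
Definition witness (G : ctx) (m : term G o) : term G ty2 :=
  eval_iseg (threshold (iseg (threshold m) (Succ @ m))) (Succ @ m).

Lemma witness_sub G D m (f : sub G D) : (witness m).[f] = witness m.[f].
Proof. reflexivity. Qed.

#[local] Hint Rewrite add_sub triangle_sub snoc_sub iseg_sub zero1_sub one1_sub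
  one2_sub threshold_sub eval_iseg_sub witness_sub : sub.

(* Without the opacity, unification unfolds the terms to their combinators. *)
Ltac ssub := repeat (progress
  (cbn [fsub tsub scons lift ids up1 up2 up3 map In] in *;
   with_strategy opaque
     [add triangle snoc initseg iseg one1 zero1 one2 threshold eval_iseg
      witness]
     (autorewrite with sub in * ))).

Lemma contC_sub G D (Y : term G ty2) (f : sub G D) :
  (contC Y).{f} = contC Y.[f].
Proof. unfold contC. rewrite !agreeE. now ssub. Qed.

Lemma contC_st_sub G D (Y : term G ty2) (f : sub G D) :
  (contC_st Y).{f} = contC_st Y.[f].
Proof. unfold contC_st, all_st, ex_st. rewrite !agreeE. now ssub. Qed.

(** * Equality and arithmetic *)

Section Derivations.

Context (T : theory).
Context (DG_T : forall G (A : form G), DG A -> T A).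

Lemma eha G (H : list (form G)) A : EHA A -> derives T H A.
Proof. intros h. apply d_ax, DG_T, dg_eha, h. Qed.

(** Derivable equality as a meta-level relation, which makes setoid rewriting available for
    derivations. *)
Definition eqd G (H : list (form G)) s (x y : term G s) : Prop :=
  derives T H (eqT x y).

Lemma eqT_app G (H : list (form G)) r s (x y : term G (r ~> s)) z :
  derives T H (eqT x y) -> derives T H (eqT (x @ z) (y @ z)).
Proof.
  intros h. apply (d_allE z) in h.
  rewrite eqT_sub in h. cbn in h. now autorewrite with sub in h.
Qed.

Lemma eqT_funI G (H : list (form G)) r s (x y : term G (r ~> s)) :
  derives T (map (fsub up1) H) (eqT (x.[up1] @ v0) (y.[up1] @ v0)) ->
  derives T H (eqT x y).
Proof. apply d_allI. Qed.

(** The implication is inside the object language because the induction on types passes under a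
    quantifier: the premise then sits in the hypothesis list and is shifted with it. *)
Lemma eqT_sym_imp s G (H : list (form G)) (x y : term G s) :
  derives T H (eqT x y --> eqT y x).
Proof.
  revert G H x y; induction s as [|r _ s IH]; intros.
  - apply eha, eha_sym.
  - apply d_impI, eqT_funI. eapply d_impE; [apply IH|].
    apply eqT_app, d_hyp. left. apply eqT_sub.
Qed.

Lemma eqT_trans_imp s G (H : list (form G)) (x y z : term G s) :
  derives T H (eqT x y --> eqT y z --> eqT x z).
Proof.
  revert G H x y z; induction s as [|r _ s IH]; intros.
  - apply eha, eha_trans.
  - apply d_impI, d_impI, eqT_funI.
    eapply d_impE; [eapply d_impE; [apply IH|]|].
    + apply eqT_app, d_hyp. right; left. apply eqT_sub.
    + apply eqT_app, d_hyp. left. apply eqT_sub.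
Qed.

#[local] Instance eqd_equiv G (H : list (form G)) s : Equivalence (@eqd G H s).
Proof.
  split; unfold eqd.
  - intros x. revert G H x; induction s as [|r _ s IH]; intros.
    + apply eha, eha_refl.
    + apply eqT_funI, IH.
  - intros x y h. exact (d_impE (eqT_sym_imp _ _ _) h).
  - intros x y z h k. exact (d_impE (d_impE (eqT_trans_imp _ _ _ _) h) k).
Qed.

(** Replacing the argument is the extensionality axiom; replacing the function is pointwise
    equality. *)
#[local] Instance App_eqd G (H : list (form G)) r s :
  Proper (@eqd G H (r ~> s) ==> @eqd G H r ==> @eqd G H s) (@App G r s).
Proof.
  intros f g fg x y xy. transitivity (f @ y).
  - assert (e : derives T H (All (r ~> s) (All r (All r
      (eqT v1 v0 --> eqT (v2 @ v1) (v2 @ v0)))))) by apply eha, eha_ext.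
    apply (d_allE f) in e. cbn in e. apply (d_allE x) in e. cbn in e.
    apply (d_allE y) in e. cbn in e. autorewrite with sub in e.
    cbn in e. autorewrite with sub in e. exact (d_impE e xy).
  - now apply eqT_app.
Qed.

Ltac to_eqd :=
  repeat match goal with
  | h : derives _ ?H (Eq0 ?x ?y) |- _ => change (eqd H x y) in h
  | |- derives _ ?H (Eq0 ?x ?y) => change (eqd H x y)
  | |- derives _ ?H (eqT ?x ?y) => change (eqd H x y)
  end.

Ltac hyp n :=
  apply d_hyp; let rec go n := match n with 0 => left | S ?n => right; go n end
  in go n; reflexivity.

(** [lam] does not commute with substitution syntactically, so beta is stated for
    an abstraction under a substitution; this also yields the reduction of nested
    abstractions. *)
Lemma beta_sub G D (H : list (form D)) r s (t : term (r :: G) s) (f : sub G D)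
    (b : term D r) :
  eqd H ((lam t).[f] @ b) t.[b .: f].
Proof.
  induction t as [s v|s c|s t u IHu w IHw]; cbn [lam tsub].
  - revert s v. apply var_case; cbn.
    + transitivity (Pi r (r ~> r) @ b @ (Pi r r @ b)); apply eha;
        [apply eha_sigma|apply eha_pi].
    + intros s v. apply eha, eha_pi.
  - apply eha, eha_pi.
  - rewrite <- IHu, <- IHw. apply eha, eha_sigma.
Qed.

Lemma beta G (H : list (form G)) r s (t : term (r :: G) s) (b : term G r) :
  eqd H (lam t @ b) t.[b .: ids].
Proof. rewrite <- beta_sub, tsub_ids. reflexivity. Qed.

Lemma beta2 G (H : list (form G)) q r s (t : term (r :: q :: G) s)
    (a : term G q) (b : term G r) :
  eqd H (lam (lam t) @ a @ b) t.[b .: a .: ids].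
Proof. rewrite <- beta_sub, beta. reflexivity. Qed.

Lemma beta3 G (H : list (form G)) p q r s (t : term (r :: q :: p :: G) s)
    (a : term G p) (b : term G q) (c : term G r) :
  eqd H (lam (lam (lam t)) @ a @ b @ c) t.[c .: b .: a .: ids].
Proof. rewrite <- 2!beta_sub, beta. reflexivity. Qed.

Lemma add_0 G (H : list (form G)) x : eqd H (add x Zero) x.
Proof. apply eha, eha_rec0. Qed.

Lemma add_S G (H : list (form G)) x y :
  eqd H (add x (Succ @ y)) (Succ @ add x y).
Proof.
  transitivity (lam (lam (Succ @ v1)) @ add x y @ y).
  - apply eha, eha_recS.
  - apply beta2.
Qed.

Lemma triangle_S G (H : list (form G)) n :
  eqd H (triangle (Succ @ n)) (Succ @ add (triangle n) n).
Proof.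
  transitivity (lam (lam (Succ @ add v1 v0)) @ triangle n @ n).
  - apply eha, eha_recS.
  - apply beta2.
Qed.

#[local] Instance add_eqd G (H : list (form G)) :
  Proper (@eqd G H o ==> @eqd G H o ==> @eqd G H o) (@add G).
Proof. intros x x' hx y y' hy. unfold add. now rewrite hx, hy. Qed.

#[local] Instance triangle_eqd G (H : list (form G)) :
  Proper (@eqd G H o ==> @eqd G H o) (@triangle G).
Proof. intros x x' hx. unfold triangle. now rewrite hx. Qed.

#[local] Instance snoc_eqd G (H : list (form G)) :
  Proper (@eqd G H o ==> @eqd G H o ==> @eqd G H o) (@snoc G).
Proof. intros x x' hx y y' hy. unfold snoc, cpair. now rewrite hx, hy. Qed.

(* The step is over an arbitrary context [K], lest setoid rewriting look for
   redexes in the context. *)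
Lemma induction_rule G (H : list (form G)) (A : form (o :: G)) (t : term G o) :
  internal A ->
  derives T H A.{Zero .: ids} ->
  (forall K, incl (map (fsub up1) H) K -> derives T K A ->
    derives T K A.{Succ @ v0 .: up1}) ->
  derives T H A.{t .: ids}.
Proof.
  intros i h0 hS. apply d_allE. eapply d_impE; [eapply d_impE|].
  - apply eha, eha_ind, i.
  - exact h0.
  - apply d_allI, d_impI, hS; [now apply incl_tl|hyp 0].
Qed.

(** The whole universal formula stays available for [B], so it can be instantiated at terms other
    than the fresh variable. *)
Lemma all_mono G (H : list (form G)) s (A B : form (s :: G)) :
  derives T H (All s A) ->
  (forall K, derives T K (All s A).{up1} -> derives T K B) ->
  derives T H (All s B).
Proof.
  intros h hB. apply (d_impE (A := All s A)); [|exact h].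
  apply d_impI, d_allI, hB. hyp 0.
Qed.

Lemma ex_elim G (H : list (form G)) s (A : form (s :: G)) B :
  derives T H (Ex s A) ->
  (forall K, incl (map (fsub up1) H) K -> derives T K A ->
    derives T K B.{up1}) ->
  derives T H B.
Proof.
  intros h hB. apply (d_exE h), hB; [now apply incl_tl|hyp 0].
Qed.

Lemma add_Sl G (H : list (form G)) x y :
  eqd H (add (Succ @ x) y) (Succ @ add x y).
Proof.
  assert (e := @induction_rule G H
    (Eq0 (add (Succ @ x.[up1]) v0) (Succ @ add x.[up1] v0)) y).
  ssub. apply e; [easy|to_eqd|intros K _ ih; to_eqd].
  - now rewrite !add_0.
  - now rewrite !add_S, ih.
Qed.

(** * Initial segments and threshold functions *)

Lemma iseg_0 G (H : list (form G)) f : eqd H (iseg f Zero) Zero.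
Proof. apply eha, eha_rec0. Qed.

Lemma iseg_S G (H : list (form G)) f n :
  eqd H (iseg f (Succ @ n)) (snoc (iseg f n) (f @ n)).
Proof.
  transitivity ((lam (lam (snoc v1 (v2 @ v0)))).[f .: ids] @ iseg f n @ n).
  - apply eha, eha_recS.
  - now rewrite 2!beta_sub.
Qed.

#[local] Instance iseg_eqd G (H : list (form G)) :
  Proper (@eqd G H ty1 ==> @eqd G H o ==> @eqd G H o) (@iseg G).
Proof.
  (* [f] occurs inside a substitution; beta expansion turns it into an argument, where rewriting can
     reach it. *)
  intros f f' hf n n' hn. unfold iseg. now rewrite <- !beta, hf, hn.
Qed.

Lemma zero1_app G (H : list (form G)) x : eqd H (zero1 @ x) Zero.
Proof. apply beta. Qed.

Lemma iseg_zero1_S G (H : list (form G)) n :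
  eqd H (iseg zero1 (Succ @ n)) (snoc (iseg zero1 n) Zero).
Proof. now rewrite iseg_S, zero1_app. Qed.

#[local] Instance threshold_eqd G (H : list (form G)) :
  Proper (@eqd G H o ==> @eqd G H ty1) (@threshold G).
Proof. intros x x' hx. unfold threshold. now rewrite hx. Qed.

Lemma one1_app G (H : list (form G)) x : eqd H (one1 @ x) (Succ @ Zero).
Proof. apply beta. Qed.

Lemma one2_app G (H : list (form G)) f : eqd H (one2 @ f) (Succ @ Zero).
Proof. apply beta. Qed.

Lemma threshold_0 G (H : list (form G)) x : eqd H (threshold Zero @ x) (Succ @ Zero).
Proof.
  rewrite <- (one1_app H x). apply eqT_app, eha, eha_rec0.
Qed.

(** The inner recursor is a mere case distinction on [x]: the [Pi] discards the recursive value, so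
    a successor is sent to [threshold m] at its predecessor. *)
Lemma threshold_S G (H : list (form G)) m x :
  eqd H (threshold (Succ @ m) @ x) (Rec o @ x @ Zero @ (Pi ty1 o @ threshold m)).
Proof.
  transitivity (lam (lam (lam (Rec o @ v0 @ Zero @ (Pi ty1 o @ v2))))
    @ threshold m @ m @ x).
  - apply eqT_app, eha, eha_recS.
  - apply beta3.
Qed.

Lemma threshold_S_0 G (H : list (form G)) m : eqd H (threshold (Succ @ m) @ Zero) Zero.
Proof. rewrite threshold_S. apply eha, eha_rec0. Qed.

Lemma threshold_S_S G (H : list (form G)) m x :
  eqd H (threshold (Succ @ m) @ (Succ @ x)) (threshold m @ x).
Proof.
  rewrite threshold_S.
  transitivity (Pi ty1 o @ threshold m @ (Rec o @ x @ Zero @ (Pi ty1 o @ threshold m)) @ x).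
  - apply eha, eha_recS.
  - apply eqT_app, eha, eha_pi.
Qed.

Lemma threshold_diag G (H : list (form G)) m : eqd H (threshold m @ m) (Succ @ Zero).
Proof.
  assert (e := @induction_rule G H (Eq0 (threshold v0 @ v0) (Succ @ Zero)) m).
  ssub. apply e; [easy|to_eqd|intros K _ ih; to_eqd].
  - apply threshold_0.
  - now rewrite threshold_S_S, ih.
Qed.

(** The strict inequality is carried by the explicit difference [k]; cut-off and argument drop by
    one together. *)
Lemma threshold_lt G (H : list (form G)) x k :
  eqd H (threshold (Succ @ add x k) @ x) Zero.
Proof.
  assert (e := @induction_rule G H
    (Eq0 (threshold (Succ @ add v0 k.[up1]) @ v0) Zero) x).
  ssub. apply e; [easy|to_eqd|intros K _ ih; to_eqd].
  - apply threshold_S_0.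
  - now rewrite threshold_S_S, add_Sl, ih.
Qed.

(** * Order and binary sequences *)

Lemma le0_intro G (H : list (form G)) x y k :
  eqd H (add x k) y -> derives T H (le0 x y).
Proof. intros h. apply (d_exI (t := k)). now ssub. Qed.

Lemma le0_eqd_imp G (H : list (form G)) x x' y y' :
  derives T H (Eq0 x x' --> Eq0 y y' --> le0 x y --> le0 x' y').
Proof.
  do 3 apply d_impI. eapply d_exE; [hyp 0|].
  ssub. apply le0_intro with v0.
  transitivity (add x.[@up1 G o] v0); [|transitivity y.[@up1 G o]].
  - apply add_eqd; [symmetry|reflexivity]. hyp 3.
  - hyp 0.
  - hyp 2.
Qed.

Lemma le0_eqd G (H : list (form G)) x x' y y' :
  eqd H x x' -> eqd H y y' -> derives T H (le0 x y) -> derives T H (le0 x' y').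
Proof.
  intros hx hy h.
  exact (d_impE (d_impE (d_impE (le0_eqd_imp _ _ _ _ _) hx) hy) h).
Qed.

Lemma le0_refl G (H : list (form G)) x : derives T H (le0 x x).
Proof. apply le0_intro with Zero, add_0. Qed.

Lemma binaryI G (H : list (form G)) f :
  derives T (map (fsub up1) H) (le0 (f.[up1] @ v0) (Succ @ Zero)) ->
  derives T H (binary f).
Proof.
  intros h. apply d_allI. eapply le0_eqd; [reflexivity|symmetry|exact h].
  apply one1_app.
Qed.

Lemma binaryE G (H : list (form G)) f x :
  derives T H (binary f) -> derives T H (le0 (f @ x) (Succ @ Zero)).
Proof.
  intros h. apply (d_allE x) in h. cbn [leT] in h. ssub.
  eapply le0_eqd; [reflexivity| |exact h]. apply one1_app.
Qed.

Lemma le0_0_1 G (H : list (form G)) : derives T H (le0 Zero (Succ @ Zero)).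
Proof. apply le0_intro with (Succ @ Zero). now rewrite add_S, add_0. Qed.

Lemma binary_zero1 G (H : list (form G)) : derives T H (binary zero1).
Proof.
  apply binaryI. ssub.
  eapply le0_eqd; [symmetry; apply zero1_app|reflexivity|apply le0_0_1].
Qed.

Lemma threshold_le1 G (H : list (form G)) m x :
  derives T H (le0 (threshold m @ x) (Succ @ Zero)).
Proof.
  assert (e := @induction_rule G H
    (All o (le0 (threshold v1 @ v0) (Succ @ Zero))) m).
  ssub. apply (d_allE x) in e; ssub; [exact e|easy| |intros K _ ih].
  - apply d_allI. eapply le0_eqd; [symmetry|reflexivity|apply le0_refl].
    apply threshold_0.
  - apply (all_mono ih). clear H e K ih. intros K ih. ssub.
    refine (d_impE (d_impI _) ih).
    (* This induction only distinguishes zero from successors and ignores its own hypothesis; the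
       successor case uses the outer one, kept at the head of the hypothesis list. *)
    assert (e := @induction_rule _
      (All o (le0 (threshold v2 @ v0) (Succ @ Zero)) :: K)
      (le0 (threshold (Succ @ v2) @ v0) (Succ @ Zero)) v0).
    ssub. apply e; [easy| |intros L hL _].
    + eapply le0_eqd; [symmetry; apply threshold_S_0|reflexivity|apply le0_0_1].
    + eapply le0_eqd; [symmetry; apply threshold_S_S|reflexivity|].
      assert (ih' := d_hyp T (hL _ (or_introl eq_refl))).
      apply (d_allE v0) in ih'. now ssub.
Qed.

Lemma binary_threshold G (H : list (form G)) m : derives T H (binary (threshold m)).
Proof. apply binaryI. ssub. apply threshold_le1. Qed.

(** The slack [k] is quantified inside the induction formula: since (x+1)+k = x+(k+1), the step uses
    the hypothesis at [Succ @ k]. *)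
Lemma iseg_threshold G (H : list (form G)) x k :
  eqd H (iseg (threshold (add x k)) x) (iseg zero1 x).
Proof.
  assert (e := @induction_rule G H
    (All o (Eq0 (iseg (threshold (add v1 v0)) v1) (iseg zero1 v1))) x).
  ssub. apply (d_allE k) in e; ssub; [exact e|easy| |intros K _ ih].
  - apply d_allI. to_eqd. now rewrite !iseg_0.
  - apply (all_mono ih). clear H e K ih. intros K ih. ssub.
    apply (d_allE (Succ @ v0)) in ih. ssub.
    to_eqd. rewrite add_S in ih.
    now rewrite iseg_zero1_S, iseg_S, add_Sl, ih, threshold_lt.
Qed.

Lemma iseg_threshold_le G (H : list (form G)) n m :
  derives T H (le0 n m) -> eqd H (iseg (threshold m) n) (iseg zero1 n).
Proof.
  intros h. apply (ex_elim h). clear h. intros K _ h. ssub. to_eqd.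
  rewrite <- h. apply iseg_threshold.
Qed.

(** Both segments begin with m zeros, with code c say, and end in 1 and 0 respectively. As
    triangle(c+1)+1 = triangle(c)+c+2, the codes differ by c+2; the right-hand side has the shape
    required by [threshold_lt]. *)
Lemma iseg_threshold_S G (H : list (form G)) m :
  eqd H (iseg (threshold m) (Succ @ m))
    (Succ @ add (iseg zero1 (Succ @ m)) (Succ @ iseg zero1 m)).
Proof.
  assert (h := iseg_threshold H m Zero). rewrite add_0 in h.
  rewrite iseg_zero1_S, iseg_S, h, threshold_diag. unfold snoc, cpair.
  now rewrite !add_S, !add_0, triangle_S, !add_Sl.
Qed.

(** * Standard functionals and continuity *)

Lemma eval_iseg_app G (H : list (form G)) e m f :
  eqd H (eval_iseg e m @ f) (e @ iseg f m).
Proof. apply beta_sub. Qed.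

(** [one1] is closed, hence standard, and being constant it majorizes every binary sequence,
    whatever parameters [f] contains. *)
Lemma st_binary G (H : list (form G)) f :
  derives T H (binary f) -> derives T H (St f).
Proof.
  (* Cutting [h] into the hypothesis list lets the quantifier rules shift it. *)
  intros h. refine (d_impE (d_impI _) h). clear h.
  apply (d_impE (A := maj f one1)).
  - apply (d_impE (A := St one1)).
    + apply d_ax, DG_T, dg_st_maj.
    + exact (d_ax _ (DG_T (dg_st_closed G one1))).
  - cbn [maj]. do 2 apply d_allI. apply d_impI. ssub. apply d_andI.
    + eapply le0_eqd; [reflexivity|symmetry; apply one1_app|].
      apply binaryE. hyp 1.
    + eapply le0_eqd; [symmetry; apply one1_app..|apply le0_refl].
Qed.

(** The same argument one type higher, with [one2] as majorant; [m] may be nonstandard. *)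
Lemma st_eval_iseg G (H : list (form G)) e m :
  derives T H (binary e) -> derives T H (St (eval_iseg e m)).
Proof.
  intros h. refine (d_impE (d_impI _) h). clear h.
  apply (d_impE (A := maj (eval_iseg e m) one2)).
  - apply (d_impE (A := St one2)).
    + apply d_ax, DG_T, dg_st_maj.
    + exact (d_ax _ (DG_T (dg_st_closed G one2))).
  - cbn [maj]. do 2 apply d_allI. apply d_impI. apply d_andI; ssub.
    + eapply le0_eqd;
        [symmetry; apply eval_iseg_app|symmetry; apply one2_app|].
      apply binaryE. ssub. hyp 1.
    + eapply le0_eqd; [symmetry; apply one2_app..|apply le0_refl].
Qed.

Lemma contC_eval_iseg G (H : list (form G)) e m :
  derives T H (contC (eval_iseg e m)).
Proof.
  (* The number [m] is a modulus for all [f] at once, since only the code of the first [m] values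
     enters. *)
  apply d_allI, d_impI, (d_exI (t := m.[up1])). rewrite agreeE. ssub.
  apply d_allI, d_impI, d_impI. to_eqd. rewrite !eval_iseg_app.
  apply App_eqd; [reflexivity|hyp 0].
Qed.

(** * The contradiction *)

Lemma witness_zero1 G (H : list (form G)) m : eqd H (witness m @ zero1) Zero.
Proof. unfold witness. rewrite eval_iseg_app, iseg_threshold_S. apply threshold_lt. Qed.

Lemma witness_threshold G (H : list (form G)) m :
  eqd H (witness m @ threshold m) (Succ @ Zero).
Proof. unfold witness. rewrite eval_iseg_app. apply threshold_diag. Qed.

Lemma contC_st_witness G (H : list (form G)) m :
  derives T H (all_st o (le0 v0 m.[up1])) ->
  derives T H (contC_st (witness m)) ->
  derives T H Bot.
Proof.
  intros hm h.
  apply (d_allE zero1) in h. cbn [fsub] in h. rewrite agreeE in h. ssub.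
  assert (h1 := d_impE (d_impE h (st_binary (binary_zero1 H)))
    (binary_zero1 H)).
  clear h. refine (d_impE (d_impI _) hm). clear hm.
  apply (ex_elim (derives_weaken h1 (incl_tl _ (incl_refl H)))).
  clear h1. intros K hK h.
  assert (hm := d_hyp T (hK _ (or_introl eq_refl))).
  assert (hN := d_andE1 h). apply d_andE2 in h.
  apply (d_allE v0) in hm.
  (* The variable [v0] is the standard modulus at [zero1]; by [hm] it is at most [m], so
     [threshold m] agrees with [zero1] below it. *)
  apply (d_allE (threshold m.[up1])) in h. ssub.
  assert (b := binary_threshold K m.[up1]).
  assert (hs : eqd K (iseg zero1 v0) (iseg (threshold m.[up1]) v0)).
  { symmetry. exact (iseg_threshold_le (d_impE hm hN)). }
  assert (e := d_impE (d_impE (d_impE h (st_binary b)) b) hs).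
  clear h hs hm hN hK. to_eqd. rewrite witness_zero1, witness_threshold in e.
  symmetry in e. exact (d_impE (eha K (eha_succ_nz Zero)) e).
Qed.

Lemma exists_upper_bound_of_st G (H : list (form G)) :
  derives T H (Ex o (all_st o (le0 v0 v1))).
Proof.
  eapply d_impE; [apply d_ax, DG_T, dg_I; exact I|].
  (* At type [o] majorization is the order, so the given bound [z] is itself the required upper
     bound. *)
  apply d_allI, d_impI, d_impI, (d_exI (t := v0)). cbn [maj]. ssub.
  apply d_allI, d_impI. hyp 0.
Qed.

End Derivations.

Theorem theorem3p22 : inconsistent (extend DG CCT_C).
Proof.
  assert (DG_T : forall G (A : form G), DG A -> extend DG CCT_C A).
  { intros G A h. now apply ext_old. }
  apply (ex_elim (exists_upper_bound_of_st DG_T [])). intros K _ hm.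
  apply (contC_st_witness DG_T (m := v0)); [exact hm|].
  assert (h : derives (extend DG CCT_C) K CCT_C.{closed_sub})
    by apply d_ax, ext_new.
  apply (d_allE (witness v0)) in h. cbn [fsub] in h.
  rewrite !contC_sub, !contC_st_sub in h.
  refine (d_impE (d_impE h _) _).
  - apply st_eval_iseg, binary_threshold; exact DG_T.
  - apply contC_eval_iseg, DG_T.
Qed.
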